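(* Let $E$ be an arbitrary (countable, not necessarily row-finite) directed graph, $K$ a field, and let $x\in L_K(E)$ be such that $L_K(E)x$ is a minimal left ideal. Then there exists a vertex $v\in P_l(E)$ such that $L_K(E)x$ is isomorphic, as a left $L_K(E)$-module, to $L_K(E)v$.
   Context: A graph $E=(E^0,E^1,r,s)$ consists of countable sets $E^0$ (vertices), $E^1$ (edges) and maps $r,s:E^1\to E^0$ (range, source). A vertex $v$ is regular if $s^{-1}(v)$ is finite and nonempty. A path is a vertex (length $0$) or a sequence $\mu=e_1\cdots e_n$ of edges with $r(e_i)=s(e_{i+1})$; $s(\mu)=s(e_1)$, $r(\mu)=r(e_n)$. A cycle is a path $e_1\cdots e_n$ ($n\ge1$) with $s(e_1)=r(e_n)$ and $s(e_i)\neq s(e_j)$ for $i\ne j$. The Leavitt path algebra $L_K(E)$ is the $K$-algebra generated by a set $\{v: v\in E^0\}$ of pairwise orthogonal idempotents and elements $\{e,e^*: e\in E^1\}$ subject to: (1) $s(e)e=er(e)=e$; (2) $r(e)e^*=e^*s(e)=e^*$; (3) $e^*e'=\delta_{e,e'}r(e)$; (4) $v=\sum_{s(e)=v}ee^*$ for every regular vertex $v$. $T(v)$ is the set of vertices $w$ such that there is a path from $v$ to $w$ (length $0$ allowed). A vertex $v$ is a bifurcation if $|s^{-1}(v)|\ge 2$. A vertex $u$ is a line point if there are neither bifurcations nor cycles at any vertex $w\in T(u)$; $P_l(E)$ is the set of line points. A left ideal $I$ of an algebra $A$ is minimal if it is nonzero and the only left ideals of $A$ it contains are $0$ and $I$.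 *)

(* Defs.v *)
From HB Require Import structures.
From mathcomp Require Import all_boot all_order all_algebra.
From mathcomp Require Import finmap.
From mathcomp Require Import boolp classical_sets functions cardinality.

Set Implicit Arguments.
Unset Strict Implicit.
Unset Printing Implicit Defensive.

Import GRing.Theory.

Local Open Scope classical_set_scope.
Local Open Scope ring_scope.
Local Open Scope quotient_scope.

Record graph := Graph {
  vertex : countType;
  edge : countType;
  src : edge -> vertex;
  rng : edge -> vertex }.

Section GraphTheory.
Variable E : graph.
Implicit Types (u v w : vertex E) (e f : edge E) (p : seq (edge E)).

Definition out v : set (edge E) := [set e | src e = v].

Definition regular v := finite_set (out v) /\ out v !=set0.

(** [is_path v p w]: the sequence of edges [p] is a path from [v] to [w]; the
    empty sequence encodes the path of length 0 at [v]. *)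
Definition is_path v p w : bool :=
  if p is e :: p' then
    [&& src e == v, path (fun e1 e2 => rng e1 == src e2) e p'
      & rng (last e p') == w]
  else v == w.

Definition is_cycle_at v p : bool :=
  [&& p != [::], is_path v p v & uniq (map (@src E) p)].

(** T(v) *)
Definition tree v : set (vertex E) := [set w | exists p, is_path v p w].

Definition bifurcation v := exists e f, [/\ out v e, out v f & e <> f].

(** P_l(E) *)
Definition line_points : set (vertex E) :=
  [set u | forall w, tree u w ->
     ~ bifurcation w /\ ~ (exists p, is_cycle_at w p)].

End GraphTheory.

(** MathComp's algebras are unital, whereas a Leavitt path algebra has a unit
    only when the graph has finitely many vertices. *)
HB.mixin Record Lmodule_isNuAlgebra (K : pzRingType) A of GRing.Lmodule K A := {
  numul : A -> A -> A;
  numulA : associative numul;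
  numulDl : left_distributive numul +%R;
  numulDr : right_distributive numul +%R;
  nuscaleAl : forall (k : K) (a b : A), k *: numul a b = numul (k *: a) b;
  nuscaleAr : forall (k : K) (a b : A), k *: numul a b = numul a (k *: b)
}.

#[short(type="nuAlgType")]
HB.structure Definition NuAlgebra (K : pzRingType) :=
  {A of GRing.Lmodule K A & Lmodule_isNuAlgebra K A}.

Notation "a ** b" := (numul a b) (at level 40, left associativity) : ring_scope.

Section LeftIdeals.
Variables (K : pzRingType) (A : nuAlgType K).
Implicit Types (I J : set A) (x : A).

Definition left_ideal I :=
  [/\ I 0, forall a b, I a -> I b -> I (a + b),
      forall (k : K) a, I a -> I (k *: a)
    & forall a b, I b -> I (a ** b)].

Definition minimal_left_ideal I :=
  [/\ left_ideal I, I <> [set 0]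
    & forall J, left_ideal J -> J `<=` I -> J = [set 0] \/ J = I].

(** A x; it contains x when A has local units, as Leavitt path algebras do. *)
Definition left_mult x : set A := [set a ** x | a in setT].

(** Isomorphism of left A-modules between left ideals; only the values of [f]
    on [I] matter. *)
Definition left_ideal_iso I J := exists f : A -> A,
  [/\ set_bij I J f,
      forall a b, I a -> I b -> f (a + b) = f a + f b,
      forall (k : K) a, I a -> f (k *: a) = k *: f a
    & forall a b, I b -> f (a ** b) = a ** f b].

End LeftIdeals.

(** The algebra given by generators and relations is the quotient of the formal
    expressions in the generators by the least congruence that contains the
    axioms of (nonunital) K-algebras and the defining relations
    (from [lc_idem] on). *)
Section LeavittPathAlgebra.
Variables (K : fieldType) (E : graph).

Inductive lterm :=
  | TZero
  | TVertex of vertex E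
  | TEdge of edge E
  | TGhost of edge E
  | TAdd of lterm & lterm
  | TScale of K & lterm
  | TMul of lterm & lterm.

HB.instance Definition _ := gen_eqMixin lterm.
HB.instance Definition _ := gen_choiceMixin lterm.

Local Notation "a ⊕ b" := (TAdd a b) (at level 50, left associativity).
Local Notation "k ⋅ a" := (TScale k a) (at level 38, right associativity).
Local Notation "a ⊗ b" := (TMul a b) (at level 40, left associativity).
Reserved Notation "a ≈ b" (at level 70).

Definition tsum (s : seq lterm) : lterm := foldr TAdd TZero s.

Inductive lcongr : lterm -> lterm -> Prop :=
  | lc_refl a : a ≈ a
  | lc_sym a b : a ≈ b -> b ≈ a
  | lc_trans a b c : a ≈ b -> b ≈ c -> a ≈ c
  | lc_add a a' b b' : a ≈ a' -> b ≈ b' -> a ⊕ b ≈ a' ⊕ b'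
  | lc_scale k a a' : a ≈ a' -> k ⋅ a ≈ k ⋅ a'
  | lc_mul a a' b b' : a ≈ a' -> b ≈ b' -> a ⊗ b ≈ a' ⊗ b'
  | lc_addA a b c : a ⊕ (b ⊕ c) ≈ a ⊕ b ⊕ c
  | lc_addC a b : a ⊕ b ≈ b ⊕ a
  | lc_add0 a : TZero ⊕ a ≈ a
  | lc_scaleA k l a : k ⋅ l ⋅ a ≈ (k * l) ⋅ a
  | lc_scale1 a : 1 ⋅ a ≈ a
  | lc_scale0 a : 0 ⋅ a ≈ TZero
  | lc_scaleDr k a b : k ⋅ (a ⊕ b) ≈ k ⋅ a ⊕ k ⋅ b
  | lc_scaleDl k l a : (k + l) ⋅ a ≈ k ⋅ a ⊕ l ⋅ a
  | lc_mulA a b c : a ⊗ (b ⊗ c) ≈ a ⊗ b ⊗ c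
  | lc_mulDl a b c : (a ⊕ b) ⊗ c ≈ a ⊗ c ⊕ b ⊗ c
  | lc_mulDr a b c : a ⊗ (b ⊕ c) ≈ a ⊗ b ⊕ a ⊗ c
  | lc_scaleAl k a b : k ⋅ (a ⊗ b) ≈ (k ⋅ a) ⊗ b
  | lc_scaleAr k a b : k ⋅ (a ⊗ b) ≈ a ⊗ (k ⋅ b)
  | lc_idem v : TVertex v ⊗ TVertex v ≈ TVertex v
  | lc_orth v w : v <> w -> TVertex v ⊗ TVertex w ≈ TZero
  | lc_src_edge e : TVertex (src e) ⊗ TEdge e ≈ TEdge e
  | lc_edge_rng e : TEdge e ⊗ TVertex (rng e) ≈ TEdge e
  | lc_rng_ghost e : TVertex (rng e) ⊗ TGhost e ≈ TGhost e
  | lc_ghost_src e : TGhost e ⊗ TVertex (src e) ≈ TGhost e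
  | lc_ck1 e : TGhost e ⊗ TEdge e ≈ TVertex (rng e)
  | lc_ck1_neq e f : e <> f -> TGhost e ⊗ TEdge f ≈ TZero
  | lc_ck2 v : regular v ->
      TVertex v ≈ tsum [seq TEdge e ⊗ TGhost e | e <- fset_set (out v)]
where "a ≈ b" := (lcongr a b).

Definition lequiv (a b : lterm) : bool := `[< a ≈ b >].

Lemma lequiv_refl : reflexive lequiv.
Proof. by move=> a; apply/asboolP; exact: lc_refl. Qed.

Lemma lequiv_sym : symmetric lequiv.
Proof.
by move=> a b; apply/idP/idP => /asboolP ab; apply/asboolP; exact: lc_sym.
Qed.

Lemma lequiv_trans : transitive lequiv.
Proof.
by move=> b a c /asboolP ab /asboolP bc; apply/asboolP; exact: lc_trans ab bc.
Qed.

Canonical lequiv_equiv := EquivRel lequiv lequiv_refl lequiv_sym lequiv_trans.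

Definition leavitt := {eq_quot lequiv}.

HB.instance Definition _ := Choice.on leavitt.
HB.instance Definition _ := EqQuotient.on leavitt.

Lemma leavitt_piP (a b : lterm) : \pi_leavitt a = \pi_leavitt b <-> a ≈ b.
Proof.
split=> [/eqmodP/asboolP //|ab]; apply/eqmodP; exact/asboolP.
Qed.

Definition lpi (a : lterm) : leavitt := \pi_leavitt a.

Definition lzero : leavitt := lpi TZero.
Definition ladd (x y : leavitt) : leavitt := lpi (repr x ⊕ repr y).
Definition lscale (k : K) (x : leavitt) : leavitt := lpi (k ⋅ repr x).
Definition lmul (x y : leavitt) : leavitt := lpi (repr x ⊗ repr y).
Definition lopp (x : leavitt) : leavitt := lscale (-1) x.

Definition lvertex (v : vertex E) : leavitt := lpi (TVertex v).
Definition ledge (e : edge E) : leavitt := lpi (TEdge e).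
Definition lghost (e : edge E) : leavitt := lpi (TGhost e).

Lemma lpiP (a b : lterm) : lpi a = lpi b <-> a ≈ b.
Proof. exact: leavitt_piP. Qed.

Lemma lpi_repr (a : lterm) : repr (lpi a) ≈ a.
Proof. by apply/leavitt_piP; rewrite reprK. Qed.

Lemma lpi_surj (x : leavitt) : exists a, x = lpi a.
Proof. by exists (repr x); rewrite /lpi reprK. Qed.

Lemma lpi_add (a b : lterm) : ladd (lpi a) (lpi b) = lpi (a ⊕ b).
Proof. by apply/lpiP; apply: lc_add; exact: lpi_repr. Qed.

Lemma lpi_scale k (a : lterm) : lscale k (lpi a) = lpi (k ⋅ a).
Proof. by apply/lpiP; apply: lc_scale; exact: lpi_repr. Qed.

Lemma lpi_mul (a b : lterm) : lmul (lpi a) (lpi b) = lpi (a ⊗ b).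
Proof. by apply/lpiP; apply: lc_mul; exact: lpi_repr. Qed.

Let lpiE := (lpi_add, lpi_scale, lpi_mul).

Lemma laddA : associative ladd.
Proof.
move=> x y z; have [[a ->] [b ->] [c ->]] := And3 (lpi_surj x) (lpi_surj y) (lpi_surj z).
by rewrite !lpiE; apply/lpiP; exact: lc_addA.
Qed.

Lemma laddC : commutative ladd.
Proof.
move=> x y; have [[a ->] [b ->]] := conj (lpi_surj x) (lpi_surj y).
by rewrite !lpiE; apply/lpiP; exact: lc_addC.
Qed.

Lemma ladd0 : left_id lzero ladd.
Proof.
by move=> x; have [a ->] := lpi_surj x; rewrite !lpiE; apply/lpiP; exact: lc_add0.
Qed.

Lemma laddN : left_inverse lzero lopp ladd.
Proof.
move=> x; have [a ->] := lpi_surj x; rewrite /lopp !lpiE; apply/lpiP.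
apply: lc_trans (lc_scale0 a); rewrite -(addNr (1 : K)); apply: lc_sym.
by apply: lc_trans (lc_scaleDl _ _ _) _; apply: lc_add (lc_refl _) (lc_scale1 _).
Qed.

HB.instance Definition _ :=
  GRing.isZmodule.Build leavitt laddA laddC ladd0 laddN.

Lemma lscaleA k l (x : leavitt) : lscale k (lscale l x) = lscale (k * l) x.
Proof.
by have [a ->] := lpi_surj x; rewrite !lpiE; apply/lpiP; exact: lc_scaleA.
Qed.

Lemma lscale1 : left_id 1 lscale.
Proof.
by move=> x; have [a ->] := lpi_surj x; rewrite !lpiE; apply/lpiP; exact: lc_scale1.
Qed.

Lemma lscaleDr : right_distributive lscale +%R.
Proof.
move=> k x y; have [[a ->] [b ->]] := conj (lpi_surj x) (lpi_surj y).
by rewrite /GRing.add /= !lpiE; apply/lpiP; exact: lc_scaleDr.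
Qed.

Lemma lscaleDl (x : leavitt) : {morph lscale^~ x : k l / k + l}.
Proof.
move=> k l; have [a ->] := lpi_surj x.
by rewrite [RHS]/GRing.add /= !lpiE; apply/lpiP; exact: lc_scaleDl.
Qed.

HB.instance Definition _ := GRing.Zmodule_isLmodule.Build K leavitt
  lscaleA lscale1 lscaleDr lscaleDl.

Lemma lmulA : associative lmul.
Proof.
move=> x y z; have [[a ->] [b ->] [c ->]] := And3 (lpi_surj x) (lpi_surj y) (lpi_surj z).
by rewrite !lpiE; apply/lpiP; exact: lc_mulA.
Qed.

Lemma lmulDl : left_distributive lmul +%R.
Proof.
move=> x y z; have [[a ->] [b ->] [c ->]] := And3 (lpi_surj x) (lpi_surj y) (lpi_surj z).
by rewrite /GRing.add /= !lpiE; apply/lpiP; exact: lc_mulDl.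
Qed.

Lemma lmulDr : right_distributive lmul +%R.
Proof.
move=> x y z; have [[a ->] [b ->] [c ->]] := And3 (lpi_surj x) (lpi_surj y) (lpi_surj z).
by rewrite /GRing.add /= !lpiE; apply/lpiP; exact: lc_mulDr.
Qed.

Lemma lscaleAl (k : K) (x y : leavitt) : k *: lmul x y = lmul (k *: x) y.
Proof.
have [[a ->] [b ->]] := conj (lpi_surj x) (lpi_surj y).
by rewrite /GRing.scale /= !lpiE; apply/lpiP; exact: lc_scaleAl.
Qed.

Lemma lscaleAr (k : K) (x y : leavitt) : k *: lmul x y = lmul x (k *: y).
Proof.
have [[a ->] [b ->]] := conj (lpi_surj x) (lpi_surj y).
by rewrite /GRing.scale /= !lpiE; apply/lpiP; exact: lc_scaleAr.
Qed.

HB.instance Definition _ := Lmodule_isNuAlgebra.Build K leavitt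
  lmulA lmulDl lmulDr lscaleAl lscaleAr.

End LeavittPathAlgebra.

Arguments lvertex K {E} v.
Arguments ledge K {E} e.
Arguments lghost K {E} e.

(* Main.v *)
Require Import Defs.
From mathcomp Require Import all_boot all_algebra.
From mathcomp Require Import classical_sets.
From mathcomp Require Import finmap boolp functions cardinality.
From mathcomp Require Import zify.

(** Let [A x] be minimal. If [a x b] is nonzero then [A (a x b)] is minimal and
    isomorphic to [A x], through right multiplication by [b]. So it is enough to
    reach a vertex [v] from [x] by multiplications on both sides, and to show
    that [v] is a line point whenever [A v] is minimal.

    Right multiplication by edges removes the ghost edges of [x], and left
    multiplication by the ghost of a shortest path then gives [k w + s] with [k]
    nonzero and [s] a combination of closed paths of positive length at a vertex
    [w]. If [w] leads to a bifurcation with outgoing edges [e] and [f] through a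
    path [m], then for a closed path [q] at [w] the conjugate [t^* q t] vanishes
    for [t = m e] or [t = m f], since otherwise both would be prefixes of
    [q q q ...]; this lowers the number of terms. If [w] leads to no
    bifurcation and [q] is a closed path at [w], minimality gives
    [y = a (w - q) y] for [y = k w + s], which is refuted in a representation:
    [y] acts as a polynomial [p(t)] with [p(0) <> 0] and [q] as a power [t^l], so
    one takes coefficients in [K[t] / ((1 - t^l) p(t))], where [t] is invertible.
    The same representation shows that [k w + s] is never zero. *)

Set Implicit Arguments.
Unset Strict Implicit.
Unset Printing Implicit Defensive.

Import GRing.Theory.
Local Open Scope classical_set_scope.
Local Open Scope ring_scope.

(** * Action on functions over a branching system *)

(** [R] is the quotient of K[X] by (1 - X^l) p. There ['X] is invertible because the modulus has the
    nonzero constant coefficient of [p], and [p] survives because its degree is below that of the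
    modulus. *)
Lemma poly_quotient (K : fieldType) (p : {poly K}) (l : nat) :
  p`_0 != 0 -> (0 < l)%N ->
  exists (R : comAlgType K) (phi : {lrmorphism {poly K} -> R}) (t' : R),
    [/\ phi 'X * t' = 1, phi p != 0 & phi ((1 - 'X^l) * p) = 0].
Proof.
move=> p0 l0.
have p_neq0 : p != 0 by apply: contraNneq p0 => ->; rewrite coef0.
have sz : size (1 - 'X^l : {poly K}) = l.+1.
  by rewrite -opprB size_polyN -polyC1 size_XnsubC.
have q_neq0 : (1 - 'X^l : {poly K}) != 0 by rewrite -size_poly_gt0 sz.
pose g := (1 - 'X^l) * p; have g_neq0 : g != 0 by rewrite mulf_neq0.
(* The quotient is taken by a monic modulus of positive degree; [mk_monic] replaces any other
   polynomial by ['X]. *)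
pose h := (lead_coef g)^-1 *: g.
have hmon : h \is monic by rewrite monicE lead_coefZ mulVf // lead_coef_eq0.
have szh : size h = (size p + l)%N.
  rewrite size_scale ?invr_eq0 ?lead_coef_eq0 // size_mul // sz addSn /=.
  by rewrite addnC.
have szp : (0 < size p)%N by rewrite size_poly_gt0.
have hE : mk_monic h = h by rewrite /mk_monic szh hmon; case: ifP => //; lia.
have inh q : in_qpoly h (q * g) = 0.
  apply: val_inj; rewrite /= hE.
  have -> : q * g = lead_coef g *: q * h.
    by rewrite -scalerAr -scalerAl scalerA mulVf ?scale1r // lead_coef_eq0.
  by rewrite Pdiv.RingMonic.rmodp_mull.
exists ({poly %/ h} : comAlgType K), (in_qpoly h).
(* From g = g_0 + X s it follows that - s / g_0 is inverse to X modulo g. *)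
pose s := \poly_(i < (size g).-1) g`_i.+1.
have gE : g = (g`_0)%:P + 'X * s.
  apply/polyP => -[|i]; rewrite coefD coefC coefXM /= ?addr0 // add0r coef_poly.
  case: ltnP => // si; rewrite nth_default //.
  by move: si; move: (size g) => [|n].
have g0 : g`_0 = p`_0.
  by rewrite coef0M coefB coef1 coefXn (ltn_eqF l0) subr0 mul1r.
exists (in_qpoly h (- (g`_0)^-1 *: s)); split.
- apply/eqP; rewrite -rmorphM -(rmorph1 (in_qpoly h)) -subr_eq0 -rmorphB.
  suff -> : 'X * (- (g`_0)^-1 *: s) - 1 = (- (g`_0)^-1)%:P * g by apply/eqP; exact: inh.
  rewrite [X in _ = _ * X]gE mulrDr -polyCM mulNr mulVf ?g0 // polyCN addrC mul_polyC.
  by rewrite -scalerAr.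
- apply: contraNneq p_neq0 => /(congr1 val) /=.
  by rewrite Pdiv.CommonRing.rmodp_small => [->//|]; rewrite hE szh -addn1 leq_add.
- by rewrite -[_ * p]mul1r; exact: inh.
Qed.

Section BranchingSystem.
Variable E : graph.
Implicit Types (v w : vertex E) (e f : edge E) (k j : nat).

(** A branching system on [vertex E * nat]: for each [v] the sets
    [{bcons e k | k}], with [e] an edge out of [v], are disjoint infinite subsets
    of [nat], which cover [nat] when [v] is regular (Euclidean division by the
    number of edges) but not necessarily when [v] is an infinite emitter. At a
    vertex with a single outgoing edge [e], [bcons e] is the identity, so a closed
    path without exits at [v] fixes all points [(v, k)]. *)
Definition bcons e k : nat :=
  if `[< regular (src e) >]
  then let s := enum_fset (fset_set (out (src e))) in (k * size s + index e s)%N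
  else choice.pickle (e, k).

(** At a vertex that is not regular, a number may decode to no pair or to an edge with another
    source; such a point begins with no edge. This is harmless, since relation (4) constrains
    regular vertices only. *)
Definition buncons (x : vertex E * nat) : option (edge E * nat) :=
  if `[< regular x.1 >]
  then let s := enum_fset (fset_set (out x.1)) in
       omap (fun e => (e, x.2 %/ size s)%N) (onth s (x.2 %% size s))
  else obind (fun ek : edge E * nat => if src ek.1 == x.1 then Some ek else None)
         (pickle_inv x.2).

Lemma regular_fsetE v e : regular v ->
  (e \in enum_fset (fset_set (out v))) = (src e == v).
Proof.
move=> [fin _]; rewrite -[LHS]/(e \in fset_set (out v)) in_fset_set //.
by apply/idP/eqP; rewrite in_setE.
Qed.

Lemma regular_size v : regular v ->
  (0 < size (enum_fset (fset_set (out v))))%N.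
Proof.
move=> rv; have [_ [e ve]] := rv; rewrite -has_predT; apply/hasP; exists e => //.
by rewrite regular_fsetE //; apply/eqP.
Qed.

Lemma buncons_cons e k : buncons (src e, bcons e k) = Some (e, k).
Proof.
rewrite /buncons /bcons /=; case: asboolP => rv; last first.
  by rewrite pickleK_inv /= eqxx.
have es : e \in enum_fset (fset_set (out (src e))) by rewrite regular_fsetE.
rewrite modnMDl divnMDl ?regular_size // modn_small ?index_mem //.
by rewrite divn_small ?index_mem // addn0 onthE (nth_map e) ?index_mem // nth_index.
Qed.

Lemma bconsK v k e j : buncons (v, k) = Some (e, j) -> v = src e /\ bcons e j = k.
Proof.
rewrite /buncons /bcons /=; case: asboolP => rv.
  set s := enum_fset _; set i := (k %% size s)%N.
  have si : (i < size s)%N by rewrite ltn_mod regular_size.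
  rewrite onthE (nth_map e) //= => -[ee <-].
  have es : e \in s by rewrite -ee mem_nth.
  have ve : v = src e by apply/eqP; rewrite eq_sym -regular_fsetE.
  split=> //; rewrite -ve asboolT // -/s -[X in index X]ee index_uniq //.
    by rewrite -divn_eq.
  exact: fset_uniq.
have := @pickle_invK (edge E * nat)%type k; case: pickle_inv => //= [[e' j']] /= kE.
by case: eqP => // ve [? ?]; subst; split=> //; rewrite asboolF.
Qed.

Lemma buncons_regular v k : regular v -> buncons (v, k) <> None.
Proof.
move=> rv; rewrite /buncons /= asboolT //.
set s := enum_fset _; have si : (k %% size s < size s)%N.
  by rewrite ltn_mod regular_size.
by rewrite onthE; case: s si => // a s si; rewrite (nth_map a).
Qed.

Lemma regular_nobif e : ~ bifurcation (src e) -> out (src e) = [set e].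
Proof.
move=> nb; apply/seteqP; split=> [f /= fe|f /= -> //].
by apply: contrapT => ne; apply: nb; exists f, e.
Qed.

Lemma buncons_nobif e k : ~ bifurcation (src e) -> buncons (src e, k) = Some (e, k).
Proof.
move=> /regular_nobif oe.
have re : regular (src e) by split; rewrite oe //; exists e.
rewrite /buncons /= asboolT //.
have -> : enum_fset (fset_set (out (src e))) = [:: e].
  apply: perm_small_eq => //; apply: uniq_perm => // f.
  rewrite regular_fsetE // inE.
  by apply/eqP/eqP => [fe|->//]; have : out (src e) f by []; rewrite oe.
by rewrite /= modn1 divn1.
Qed.

End BranchingSystem.

Section Representation.
Variables (K : fieldType) (E : graph) (R : comAlgType K).
Variables (t t' : R).
Hypothesis tt' : t * t' = 1.
Local Notation X := (vertex E * nat)%type.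
Local Notation F := (X -> R).

(** Vertices act as restrictions, edges and ghost edges as translations along
    [bcons] scaled by [t] and [t']. *)
Fixpoint tact (a : lterm K E) (u : F) : F :=
  match a with
  | TZero => fun _ => 0
  | TVertex v => fun x => if x.1 == v then u x else 0
  | TEdge e => fun x =>
      if buncons x is Some (f, j) then
        if f == e then t * u (rng e, j) else 0
      else 0
  | TGhost e => fun x =>
      if x.1 == rng e then t' * u (src e, bcons e x.2) else 0
  | TAdd a b => fun x => tact a u x + tact b u x
  | TScale k a => fun x => k *: tact a u x
  | TMul a b => tact a (tact b u)
  end.

Lemma tactD a u u' x : tact a (fun y => u y + u' y) x = tact a u x + tact a u' x.
Proof.
elim: a u u' x => /= [|v|e|e|a IHa b IHb|k a IHa|a IHa b IHb] u u' x.
- by rewrite addr0.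
- by case: eqP => // _; rewrite addr0.
- case: buncons => [[f j]|]; last by rewrite addr0.
  by case: eqP => _; rewrite ?mulrDr ?addr0.
- by case: eqP => _; rewrite ?mulrDr ?addr0.
- by rewrite IHa IHb addrACA.
- by rewrite IHa scalerDr.
- by rewrite -IHa; congr tact; apply/funext => y; exact: IHb.
Qed.

Lemma tactZ a c u x : tact a (fun y => c *: u y) x = c *: tact a u x.
Proof.
elim: a u x => /= [|v|e|e|a IHa b IHb|k a IHa|a IHa b IHb] u x.
- by rewrite scaler0.
- by case: eqP => // _; rewrite scaler0.
- case: buncons => [[f j]|]; last by rewrite scaler0.
  by case: eqP => _; rewrite ?scalerAr ?scaler0.
- by case: eqP => _; rewrite ?scalerAr ?scaler0.
- by rewrite IHa IHb scalerDr.
- by rewrite IHa !scalerA mulrC.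
- by rewrite -IHa; congr tact; apply/funext => y; exact: IHb.
Qed.

Lemma tact0 a : tact a (fun=> 0) = fun=> 0.
Proof. by apply/funext => x; have := tactZ a 0 (fun=> 0) x; rewrite !scale0r. Qed.

(** So e e^* is the restriction to the points beginning with [e], which turns relation (4) into a
    covering statement. *)
Lemma tact_edge_ghost e u x : tact (TMul (TEdge K e) (TGhost K e)) u x =
  if buncons x is Some (f, _) then if f == e then u x else 0 else 0.
Proof.
case: x => v k /=; case E1 : buncons => [[f j]|] //.
case: eqP => // fe; subst f; rewrite eqxx mulrA tt' mul1r.
by have [-> ->] := bconsK E1.
Qed.

(** This lets the action descend to the quotient. Relation (3) rests on the disjointness of the
    pieces of distinct edges and on [tt'], relation (4) on the covering of regular vertices. *)
Lemma tact_congr a b : lcongr a b -> tact a = tact b.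
Proof.
elim => {a b} //=.
- by move=> a b c _ -> _ ->.
- by move=> a a' b b' _ -> _ ->.
- by move=> k a a' _ ->.
- by move=> a a' b b' _ -> _ ->.
- by move=> a b c; apply/funext => u; apply/funext => x; rewrite addrA.
- by move=> a b; apply/funext => u; apply/funext => x; rewrite addrC.
- by move=> a; apply/funext => u; apply/funext => x; rewrite add0r.
- by move=> k l a; apply/funext => u; apply/funext => x; rewrite scalerA.
- by move=> a; apply/funext => u; apply/funext => x; rewrite scale1r.
- by move=> a; apply/funext => u; apply/funext => x; rewrite scale0r.
- by move=> k a b; apply/funext => u; apply/funext => x; rewrite scalerDr.
- by move=> k l a; apply/funext => u; apply/funext => x; rewrite scalerDl.
- by move=> a b c; apply/funext => u; apply/funext => x; rewrite tactD.
- by move=> k a b; apply/funext => u; apply/funext => x; rewrite tactZ.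
- by move=> v; apply/funext => u; apply/funext => x; case: (x.1 == v).
- move=> v w vw; apply/funext => u; apply/funext => x.
  by case: eqP => // ->; case: eqP.
- move=> e; apply/funext => u; apply/funext => -[v k] /=.
  case E1 : buncons => [[f j]|]; last by case: ifP.
  by case: (f =P e) => [fe|]; [have [-> _] := bconsK E1; rewrite fe eqxx | case: ifP].
- by move=> e; apply/funext => u; apply/funext => x /=; rewrite eqxx.
- by move=> e; apply/funext => u; apply/funext => x /=; case: (x.1 == rng e).
- by move=> e; apply/funext => u; apply/funext => x /=; rewrite eqxx.
- move=> e; apply/funext => u; apply/funext => -[v k] /=.
  case: eqP => // ->; rewrite buncons_cons eqxx mulrA [t' * t]mulrC tt' mul1r //.
- move=> e f ef; apply/funext => u; apply/funext => -[v k] /=.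
  by case: eqP => // _; rewrite buncons_cons; case: eqP => // _; rewrite mulr0.
- move=> v rv; apply/funext => u; apply/funext => -[w k].
  rewrite [LHS]/=; set s := enum_fset _.
  (* Distinct edges have disjoint pieces, so without repetitions in [r] the restrictions add up to
     the restriction to their union. *)
  have sumE (r : seq (edge E)) : uniq r ->
     tact (tsum [seq TMul (TEdge K e) (TGhost K e) | e <- r]) u (w, k) =
     if buncons (w, k) is Some (f, _) then if f \in r then u (w, k) else 0 else 0.
    elim: r => [|e r IH] /=; first by case: buncons => [[]|].
    move=> /andP[er ur].
    have /= -> := tact_edge_ghost e u (w, k); rewrite IH //.
    case: buncons => [[f _]|]; last by rewrite addr0.
    rewrite inE; case: (f =P e) => [->|_] /=; last by rewrite add0r.
    by rewrite (negPf er) addr0.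
  rewrite sumE ?fset_uniq //=.
  case E1 : buncons => [[f j]|].
    by rewrite regular_fsetE //; have [-> _] := bconsK E1.
  by case: eqP => // wv; subst w; have := buncons_regular rv E1.
Qed.

Definition act (a : leavitt K E) : F -> F := tact (repr a).

Lemma act_pi a : act (lpi a) = tact a.
Proof. exact/tact_congr/lpi_repr. Qed.

Lemma act0 : act 0 = fun _ _ => 0. Proof. exact: act_pi. Qed.

Lemma actD a b u x : act (a + b) u x = act a u x + act b u x.
Proof.
have [[c ->] [d ->]] := conj (lpi_surj a) (lpi_surj b).
by rewrite /GRing.add /= lpi_add !act_pi.
Qed.

Lemma actZ k a u x : act (k *: a) u x = k *: act a u x.
Proof.
by have [c ->] := lpi_surj a; rewrite {1}/GRing.scale /= lpi_scale !act_pi.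
Qed.

Lemma actM a b u : act (a ** b) u = act a (act b u).
Proof.
have [[c ->] [d ->]] := conj (lpi_surj a) (lpi_surj b).
by rewrite /numul /= lpi_mul !act_pi.
Qed.

Lemma act_zero a : act a (fun=> 0) = fun=> 0.
Proof. exact: tact0. Qed.

End Representation.

(** * Left ideals and local units *)

Section NuAlgebraTheory.
Variables (K : pzRingType) (A : nuAlgType K).
Implicit Types (a b c : A).

Lemma numul0l b : (0 : A) ** b = 0.
Proof. by apply: (@addrI A (0 ** b)); rewrite -numulDl !addr0. Qed.

Lemma numul0r a : a ** (0 : A) = 0.
Proof. by apply: (@addrI A (a ** 0)); rewrite -numulDr !addr0. Qed.

Lemma numulNl a b : (- a) ** b = - (a ** b).
Proof. by apply: (@addrI A (a ** b)); rewrite -numulDl !subrr numul0l. Qed.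

Lemma numulBl a b c : (a - b) ** c = a ** c - b ** c.
Proof. by rewrite numulDl numulNl. Qed.

Lemma numul_suml I (r : seq I) (P : pred I) (F : I -> A) b :
  (\sum_(i <- r | P i) F i) ** b = \sum_(i <- r | P i) F i ** b.
Proof.
by rewrite (big_morph (fun a => a ** b) (fun x y => numulDl x y b) (numul0l b)).
Qed.

Lemma numul_sumr I (r : seq I) (P : pred I) (F : I -> A) a :
  a ** (\sum_(i <- r | P i) F i) = \sum_(i <- r | P i) a ** F i.
Proof. by rewrite (big_morph (fun b => a ** b) (numulDr a) (numul0r a)). Qed.

Lemma nuscale_sumr I (r : seq I) (P : pred I) (k : I -> K) (F : I -> A) a :
  a ** (\sum_(i <- r | P i) k i *: F i) = \sum_(i <- r | P i) k i *: (a ** F i).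
Proof. by rewrite numul_sumr; apply: eq_bigr => i _; rewrite nuscaleAr. Qed.

Lemma nuscale_suml I (r : seq I) (P : pred I) (k : I -> K) (F : I -> A) b :
  (\sum_(i <- r | P i) k i *: F i) ** b = \sum_(i <- r | P i) k i *: (F i ** b).
Proof. by rewrite numul_suml; apply: eq_bigr => i _; rewrite nuscaleAl. Qed.

Lemma left_ideal_mult (x : A) : left_ideal (left_mult x).
Proof.
split; first by exists 0; rewrite ?numul0l.
- by move=> _ _ [a _ <-] [b _ <-]; exists (a + b); rewrite ?numulDl.
- by move=> k _ [a _ <-]; exists (k *: a); rewrite ?nuscaleAl.
- by move=> a _ [b _ <-]; exists (a ** b); rewrite ?numulA.
Qed.

Lemma left_multM (a x y : A) : left_mult x y -> left_mult x (a ** y).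
Proof. by have [_ _ _] := left_ideal_mult x; exact. Qed.

Lemma sub_left_mult (x y : A) : left_mult x y -> left_mult y `<=` left_mult x.
Proof. by move=> xy _ [a _ <-]; exact: left_multM. Qed.

(** The kernel of right multiplication by [b] on [A x] is a left ideal. *)
Lemma minimal_mulr (x b : A) :
  minimal_left_ideal (left_mult x) -> left_mult (x ** b) <> [set 0] ->
  minimal_left_ideal (left_mult (x ** b)) /\
  left_ideal_iso (left_mult x) (left_mult (x ** b)).
Proof.
move=> [_ _ minx] xb0.
(* By minimality the kernel is 0 or all of [A x]; the latter would make [A (x b)] zero. *)
have inj c : left_mult x c -> c ** b = 0 -> c = 0.
  pose J := [set c | left_mult x c /\ c ** b = 0].
  have lJ : left_ideal J.
    have [h0 hD hZ hM] := left_ideal_mult x; split.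
    - by split=> //; rewrite numul0l.
    - by move=> ? ? [? c0] [? d0]; split; [exact: hD | rewrite numulDl c0 d0 addr0].
    - by move=> k ? [? c0]; split; [exact: hZ | rewrite -nuscaleAl c0 scaler0].
    - by move=> a ? [? c0]; split; [exact: hM | rewrite -numulA c0 numul0r].
  move=> xc cb; have [J0|JE] := minx J lJ (fun _ => @proj1 _ _).
    by have : J c by []; rewrite J0.
  case: xb0; apply/seteqP; split=> [_ [a _ <-]|_ ->]; last first.
    by have [] := left_ideal_mult (x ** b).
  have : J (a ** x) by rewrite JE; exists a.
  by case=> _ /=; rewrite -numulA.
split; last first.
  exists (fun c => c ** b); split.
  - split.
    + by move=> _ [a _ <-]; exists a; rewrite // numulA.
    + move=> c d; rewrite !in_setE => xc xd /= cd; apply/eqP; rewrite -subr_eq0.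
      apply/eqP/inj; last by rewrite numulBl cd subrr.
      have [_ hD hZ _] := left_ideal_mult x.
      by apply: hD => //; rewrite -scaleN1r; exact: hZ.
    + by move=> _ [a _ <-]; exists (a ** x); [exists a | rewrite numulA].
  - by move=> *; rewrite numulDl.
  - by move=> *; rewrite nuscaleAl.
  - by move=> *; rewrite numulA.
split=> //; first exact: left_ideal_mult.
move=> J lJ Jxb.
(* A left ideal inside [A (x b)] is compared with its preimage in [A x], which is 0 or
   everything. *)
pose J' := [set c | left_mult x c /\ J (c ** b)].
have lJ' : left_ideal J'.
  have [h0 hD hZ hM] := left_ideal_mult x; have [j0 jD jZ jM] := lJ; split.
  - by split=> //; rewrite numul0l.
  - by move=> ? ? [? ?] [? ?]; split; [exact: hD | rewrite numulDl; exact: jD].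
  - by move=> k ? [? ?]; split; [exact: hZ | rewrite -nuscaleAl; exact: jZ].
  - by move=> a ? [? ?]; split; [exact: hM | rewrite -numulA; exact: jM].
have [J0|JE] := minx J' lJ' (fun _ => @proj1 _ _); [left|right].
  apply/seteqP; split=> [y Jy|_ ->]; last by case: lJ.
  have [a _ ay] := Jxb _ Jy.
  have : J' (a ** x) by split; [exists a | rewrite -numulA ay].
  by rewrite J0 /= => ax0; rewrite -ay numulA ax0 numul0l.
apply/seteqP; split=> // _ [a _ <-].
have : J' (a ** x) by rewrite JE; exists a.
by case=> _ /=; rewrite -numulA.
Qed.

End NuAlgebraTheory.

(** * Relations of the Leavitt path algebra, local units and minimality *)

Section Relations.
Variables (K : fieldType) (E : graph).
Local Notation L := (leavitt K E).
Implicit Types (v w : vertex E) (e f : edge E) (x y : L).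
Local Notation V := (lvertex K).

Lemma vertex_mul v w : V v ** V w = if v == w then V v else 0 :> L.
Proof.
rewrite /numul /= lpi_mul; case: eqP => [->|vw]; apply/lpiP.
  exact: lc_idem.
exact: lc_orth.
Qed.

Lemma src_edge e : V (src e) ** ledge K e = ledge K e.
Proof. by rewrite /numul /= lpi_mul; apply/lpiP; exact: lc_src_edge. Qed.

Lemma edge_rng e : ledge K e ** V (rng e) = ledge K e.
Proof. by rewrite /numul /= lpi_mul; apply/lpiP; exact: lc_edge_rng. Qed.

Lemma rng_ghost e : V (rng e) ** lghost K e = lghost K e.
Proof. by rewrite /numul /= lpi_mul; apply/lpiP; exact: lc_rng_ghost. Qed.

Lemma ghost_src e : lghost K e ** V (src e) = lghost K e.
Proof. by rewrite /numul /= lpi_mul; apply/lpiP; exact: lc_ghost_src. Qed.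

Lemma ghost_edge e f :
  lghost K e ** ledge K f = if e == f then V (rng e) else 0 :> L.
Proof.
rewrite /numul /= lpi_mul; case: eqP => [->|ef]; apply/lpiP.
  exact: lc_ck1.
exact: lc_ck1_neq.
Qed.

Lemma vertex_edge v e : V v ** ledge K e = if src e == v then ledge K e else 0.
Proof.
rewrite -{1}src_edge numulA vertex_mul eq_sym.
by case: eqP => [<-|_]; rewrite ?src_edge ?numul0l.
Qed.

Lemma ghost_vertex v e : lghost K e ** V v = if src e == v then lghost K e else 0.
Proof.
rewrite -{1}ghost_src -numulA vertex_mul.
by case: eqP => [_|_]; rewrite ?ghost_src ?numul0r.
Qed.

Lemma ck2 v (s : seq (edge E)) : uniq s -> regular v ->
  (forall e, (e \in s) = (src e == v)) ->
  \sum_(e <- s) ledge K e ** lghost K e = V v.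
Proof.
move=> us rv sv; rewrite (perm_big (enum_fset (fset_set (out v)))); last first.
  by apply: uniq_perm => // e; rewrite sv regular_fsetE.
rewrite /lvertex; have /lpiP -> := lc_ck2 K rv.
elim: (enum_fset _) => [|e r IH]; first by rewrite big_nil.
by rewrite big_cons /= -lpi_add IH -lpi_mul.
Qed.

Lemma leavitt_ind (P : L -> Prop) :
  P 0 -> (forall v, P (V v)) -> (forall e, P (ledge K e)) ->
  (forall e, P (lghost K e)) -> (forall x y, P x -> P y -> P (x + y)) ->
  (forall k x, P x -> P (k *: x)) -> (forall x y, P x -> P y -> P (x ** y)) ->
  forall x, P x.
Proof.
move=> P0 PV Pe Pg PD PZ PM x; have [a ->] := lpi_surj x.
elim: a => [|v|e|e|a IHa b IHb|k a IHa|a IHa b IHb].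
- exact: P0.
- exact: PV.
- exact: Pe.
- exact: Pg.
- by rewrite -lpi_add; exact: PD.
- by rewrite -lpi_scale; exact: PZ.
- by rewrite -lpi_mul; exact: PM.
Qed.

Lemma sum_vertex_l (F : seq (vertex E)) v x : uniq F -> v \in F -> V v ** x = x ->
  (\sum_(w <- F) V w) ** x = x.
Proof.
move=> uF vF vx; rewrite numul_suml (bigD1_seq v) //= vx big1 ?addr0 // => w wv.
by rewrite -vx numulA vertex_mul (negPf wv) numul0l.
Qed.

Lemma sum_vertex_r (F : seq (vertex E)) v x : uniq F -> v \in F -> x ** V v = x ->
  x ** (\sum_(w <- F) V w) = x.
Proof.
move=> uF vF xv; rewrite numul_sumr (bigD1_seq v) //= xv big1 ?addr0 // => w wv.
by rewrite -xv -numulA vertex_mul eq_sym (negPf wv) numul0r.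
Qed.

(** Stating this for all larger [F], not for one set, makes the induction pass through sums and
    products by concatenating the two lists. *)
Lemma local_unit x : exists F0 : seq (vertex E), forall F, uniq F ->
  {subset F0 <= F} ->
  (\sum_(v <- F) V v) ** x = x /\ x ** (\sum_(v <- F) V v) = x.
Proof.
elim/leavitt_ind: x.
- by exists [::] => F _ _; rewrite numul0l numul0r.
- move=> v; exists [:: v] => F uF sF; have vF := sF v (mem_head _ _).
  by split; [apply: sum_vertex_l vF _ | apply: sum_vertex_r vF _];
    rewrite // vertex_mul eqxx.
- move=> e; exists [:: src e; rng e] => F uF sF; split.
    by apply: (sum_vertex_l (v := src e)); rewrite ?src_edge ?sF ?inE ?eqxx.
  by apply: (sum_vertex_r (v := rng e)); rewrite ?edge_rng ?sF ?inE ?eqxx ?orbT.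
- move=> e; exists [:: src e; rng e] => F uF sF; split.
    by apply: (sum_vertex_l (v := rng e)); rewrite ?rng_ghost ?sF ?inE ?eqxx ?orbT.
  by apply: (sum_vertex_r (v := src e)); rewrite ?ghost_src ?sF ?inE ?eqxx.
- move=> x y [Fx hx] [Fy hy]; exists (Fx ++ Fy) => F uF sF.
  have [|x1 x2] := hx F uF; first by move=> v vF; apply: sF; rewrite mem_cat vF.
  have [|y1 y2] := hy F uF; first by move=> v vF; apply: sF; rewrite mem_cat vF orbT.
  by rewrite numulDl numulDr x1 x2 y1 y2.
- move=> k x [Fx hx]; exists Fx => F uF sF; have [x1 x2] := hx F uF sF.
  by rewrite -nuscaleAr -nuscaleAl x1 x2.
- move=> x y [Fx hx] [Fy hy]; exists (Fx ++ Fy) => F uF sF.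
  have [|x1 x2] := hx F uF; first by move=> v vF; apply: sF; rewrite mem_cat vF.
  have [|y1 y2] := hy F uF; first by move=> v vF; apply: sF; rewrite mem_cat vF orbT.
  by rewrite numulA x1 -numulA y2.
Qed.

Lemma left_unit x : exists u, u ** x = x.
Proof.
have [F0 /(_ (undup F0) (undup_uniq _))] := local_unit x.
by case=> [v|]; [rewrite mem_undup | exists (\sum_(v <- undup F0) V v)].
Qed.

Lemma right_unit x : exists2 F : seq (vertex E), uniq F & x = \sum_(v <- F) x ** V v.
Proof.
have [F0 /(_ (undup F0) (undup_uniq _))] := local_unit x.
case=> [v|_ h]; first by rewrite mem_undup.
by exists (undup F0); rewrite ?undup_uniq // -numul_sumr h.
Qed.

Lemma left_mult_refl x : left_mult x x.
Proof. by have [u ux] := left_unit x; exists u. Qed.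

Lemma left_mult_neq0 x : x <> 0 -> left_mult x <> [set 0].
Proof. by move=> x0 xE; apply: x0; have := left_mult_refl x; rewrite xE. Qed.

Lemma minimal_neq0 x : minimal_left_ideal (left_mult x) -> x <> 0.
Proof.
case=> _ nz _ x0; apply: nz; rewrite x0; apply/seteqP; split=> [_ [a _ <-]|_ ->].
  by rewrite numul0r.
by exists 0; rewrite ?numul0r.
Qed.

Lemma minimal_mull a x : minimal_left_ideal (left_mult x) -> a ** x <> 0 ->
  left_mult (a ** x) = left_mult x.
Proof.
move=> [_ _ minx] ax0.
have [||//] := minx _ (left_ideal_mult (a ** x)).
  by apply: sub_left_mult; exists a.
by move/left_mult_neq0: ax0.
Qed.

(** The right factor replaces the ideal by an isomorphic one; the left factor then leaves it
    unchanged. *)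
Lemma minimal_conj a b x : minimal_left_ideal (left_mult x) ->
  a ** x ** b <> 0 -> minimal_left_ideal (left_mult (a ** x ** b)) /\
  left_ideal_iso (left_mult x) (left_mult (a ** x ** b)).
Proof.
move=> minx axb.
have xb0 : x ** b <> 0 by move=> xb0; apply: axb; rewrite -numulA xb0 numul0r.
have [minxb iso] := minimal_mulr minx (left_mult_neq0 xb0).
by rewrite -numulA in axb *; rewrite minimal_mull.
Qed.

End Relations.

(** * Combinations of closed paths *)

Section Paths.
Variable E : graph.
Implicit Types (u v w : vertex E) (e f : edge E) (p q : seq (edge E)).

(** A path is encoded by its edges [p] and its range [w], since an empty list does not determine a
    path of length 0. *)
Definition pstart p w := if p is e :: _ then src e else w.

Fixpoint pvalid p w :=
  if p is e :: p' then (rng e == pstart p' w) && pvalid p' w else true.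

Lemma is_pathE v p w : is_path v p w = (pstart p w == v) && pvalid p w.
Proof.
case: p => [|e p] /=; first by rewrite andbT eq_sym.
congr (_ && _); elim: p e => [|f p IH] e /=; first by rewrite andbT.
by rewrite -andbA IH.
Qed.

Lemma pstart_cat p q w : pstart (p ++ q) w = pstart p (pstart q w).
Proof. by case: p. Qed.

Lemma pvalid_cat p q w :
  pvalid (p ++ q) w = pvalid p (pstart q w) && pvalid q w.
Proof. by elim: p => //= e p ->; rewrite pstart_cat andbA. Qed.

Lemma tree_trans u v w : tree u v -> tree v w -> tree u w.
Proof.
move=> [p]; rewrite is_pathE => /andP[/eqP pu pv].
move=> [q]; rewrite is_pathE => /andP[/eqP qv qw].
by exists (p ++ q); rewrite is_pathE pstart_cat pvalid_cat qv pu eqxx pv.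
Qed.

Lemma tree_edge e : tree (src e) (rng e).
Proof. by exists [:: e]; rewrite is_pathE /= !eqxx. Qed.

(** Unlike cycles, closed paths may repeat vertices; this makes them stable under concatenation. *)
Definition closed_at w p := [&& p != [::], pstart p w == w & pvalid p w].

Lemma closed_at_cat w p q : closed_at w p -> closed_at w q -> closed_at w (p ++ q).
Proof.
move=> /and3P[p0 /eqP ps pv] /and3P[q0 /eqP qs qv].
rewrite /closed_at pstart_cat pvalid_cat qs ps eqxx pv qv !andbT.
by case: p p0 {ps pv}.
Qed.

(** The part of a point of the branching system that is left after the initial
    path [p]. *)
Fixpoint strip p w (x : vertex E * nat) : option nat :=
  if p is e :: p' then
    if buncons x is Some (f, j) then
      if f == e then strip p' w (rng e, j) else None
    else None
  else if x.1 == w then Some x.2 else None.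

(** Along a path without bifurcations every [bcons] is the identity, so each point at the start of
    [p] begins with [p] and keeps its number. *)
Lemma strip_nobif p w v k :
  (forall u, tree (pstart p w) u -> ~ bifurcation u) -> pvalid p w ->
  strip p w (v, k) = if v == pstart p w then Some k else None.
Proof.
elim: p v => [//|e p IH] v /= nb /andP[/eqP re pv].
case: eqP => [->|ve].
  rewrite buncons_nobif; last by apply: nb; exists [::]; rewrite /= eqxx.
  rewrite eqxx IH ?re ?eqxx // => u pu; apply: nb.
  by apply: tree_trans (tree_edge e) _; rewrite re.
case E1 : buncons => [[f j]|] //; case: eqP => // fe; subst f.
by have [] := bconsK E1.
Qed.

End Paths.

Section PathElements.
Variables (K : fieldType) (E : graph).
Local Notation L := (leavitt K E).
Implicit Types (u v w : vertex E) (e f : edge E) (p q : seq (edge E)) (x y : L).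
Local Notation V := (lvertex K).

(** The last factor [V w] yields the path of length 0 and makes the product vanish if [w] is not the
    range of the last edge. The adjoint is [ghost_elt], with the factors in reverse order. *)
Definition path_elt p w : L := foldr (fun e x => ledge K e ** x) (V w) p.

Fixpoint ghost_elt p w : L := if p is e :: p' then ghost_elt p' w ** lghost K e else V w.

Lemma vertex_path v p w :
  V v ** path_elt p w = if pstart p w == v then path_elt p w else 0.
Proof.
case: p => [|e p] /=.
  by rewrite vertex_mul eq_sym; case: eqP => // ->.
by rewrite numulA vertex_edge; case: eqP => // _; rewrite numul0l.
Qed.

Lemma path_vertex v p w : path_elt p w ** V v = if w == v then path_elt p w else 0.
Proof.
elim: p => [|e p IH] /=; first by rewrite vertex_mul.
by rewrite -numulA IH; case: eqP => // _; rewrite numul0r.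
Qed.

Lemma path_elt_invalid p w : ~~ pvalid p w -> path_elt p w = 0.
Proof.
elim: p => //= e p IH; rewrite negb_and => /orP[re|/IH ->]; last exact: numul0r.
by rewrite -edge_rng -numulA vertex_path eq_sym (negPf re) numul0r.
Qed.

Lemma path_elt_cat p q w : path_elt p (pstart q w) ** path_elt q w = path_elt (p ++ q) w.
Proof.
elim: p => [|e p IH] /=; first by rewrite vertex_path eqxx.
by rewrite -numulA IH.
Qed.

Lemma path_edge p w e :
  path_elt p w ** ledge K e = if w == src e then path_elt (rcons p e) (rng e) else 0.
Proof.
have -> : ledge K e = path_elt [:: e] (rng e) by rewrite /= edge_rng.
case: eqP => [->|we]; first by rewrite -cats1 -path_elt_cat.
by rewrite /= edge_rng -src_edge numulA path_vertex; case: eqP => // _; rewrite numul0l.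
Qed.

Lemma ghost_path_id p w : pvalid p w -> ghost_elt p w ** path_elt p w = V w.
Proof.
elim: p => [_|e p IH] /=; first by rewrite vertex_mul eqxx.
move=> /andP[/eqP re /IH pv].
by rewrite numulA -[_ ** lghost K e ** _]numulA ghost_edge eqxx -numulA vertex_path
  re eqxx.
Qed.

(** Relation (3) cancels equal edges one by one and kills the product at the first mismatch. The
    bound on lengths ensures that no ghost edge is left over. *)
Lemma ghost_path p u q w : (size p <= size q)%N ->
  ghost_elt p u ** path_elt q w = 0 \/
  exists s, [/\ q = p ++ s, pstart s w = u, pvalid s w
    & ghost_elt p u ** path_elt q w = path_elt s w].
Proof.
case: (boolP (pvalid q w)) => [|/path_elt_invalid -> _]; last by left; rewrite numul0r.
elim: p q => [|e p IH] q /= qv pq.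
  by rewrite vertex_path; case: eqP => [qu|_]; [right; exists q | left].
case: q qv pq => //= f q /andP[/eqP rf qv] pq.
rewrite numulA -[_ ** lghost K e ** _]numulA ghost_edge.
case: eqP => [ef|_]; last by left; rewrite numul0r numul0l.
subst f; rewrite -numulA vertex_path rf eqxx.
by have [|[s [-> su sv ->]]] := IH q qv pq; [left | right; exists s].
Qed.

(** The bound [n] on the number of terms is the measure that decreases in [unital_vertex]. *)
Definition closed_comb n w x := exists l : seq (K * seq (edge E)),
  [/\ (size l <= n)%N, all (fun c => closed_at w c.2) l
    & x = \sum_(c <- l) c.1 *: path_elt c.2 w].

Lemma closed_comb0 n w : closed_comb n w 0.
Proof. by exists [::]; rewrite big_nil. Qed.

Lemma closed_combD n m w x y :
  closed_comb n w x -> closed_comb m w y -> closed_comb (n + m) w (x + y).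
Proof.
move=> [l [sl al ->]] [r [sr ar ->]]; exists (l ++ r).
by rewrite size_cat leq_add // all_cat al ar big_cat.
Qed.

Lemma closed_combZ n w k x : closed_comb n w x -> closed_comb n w (k *: x).
Proof.
move=> [l [sl al ->]]; exists [seq (k * c.1, c.2) | c <- l].
rewrite size_map all_map; split=> //; rewrite big_map scaler_sumr.
by apply: eq_bigr => c _; rewrite scalerA.
Qed.

Lemma closed_comb_path n w p : closed_at w p -> closed_comb n.+1 w (path_elt p w).
Proof.
by exists [:: (1, p)]; rewrite /= andbT big_seq1 scale1r.
Qed.

Lemma closed_comb_sum (T : eqType) w (l : seq T) (k : T -> K) (g : T -> L) :
  {in l, forall c, closed_comb 1 w (g c)} -> closed_comb (size l) w (\sum_(c <- l) k c *: g c).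
Proof.
elim: l => [_|c l IH gl]; first by rewrite big_nil; exact: closed_comb0.
rewrite big_cons /= -add1n; apply: closed_combD.
  by apply/closed_combZ/gl; rewrite mem_head.
by apply: IH => d dl; apply: gl; rewrite inE dl orbT.
Qed.

Definition unital_at n w x :=
  exists k y, [/\ k != 0, closed_comb n w y & x = k *: V w + y].

Section Action.
Variables (R : comAlgType K) (phi : {lrmorphism {poly K} -> R}) (t' : R).
Hypothesis tt' : phi 'X * t' = 1.
Local Notation act := (act (phi 'X) t').

Lemma act_path p w (g : vertex E * nat -> R) z : act (path_elt p w) g z =
  if strip p w z is Some j then phi 'X^(size p) * g (w, j) else 0.
Proof.
elim: p z => [|e p IH] [v k] /=.
  rewrite expr0 rmorph1 /lvertex (act_pi tt') /=.
  by case: eqP => // ->; rewrite mul1r.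
rewrite (actM tt') /ledge (act_pi tt') /=.
case: buncons => [[f j]|] //; case: eqP => // _; rewrite IH.
by case: strip => [i|]; rewrite ?mulr0 // exprS rmorphM mulrA.
Qed.

Lemma act_sum (l : seq (K * seq (edge E))) w (g : vertex E * nat -> R) z :
  act (\sum_(c <- l) c.1 *: path_elt c.2 w) g z =
  \sum_(c <- l) c.1 *: act (path_elt c.2 w) g z.
Proof.
elim: l => [|c l IH]; first by rewrite !big_nil (act0 _ tt').
by rewrite !big_cons (actD tt') (actZ tt') IH.
Qed.

End Action.

(** Closed paths have positive length, so they contribute only positive powers and the constant
    coefficient stays that of the vertex term. [P] selects the paths that act nontrivially at a
    given point. *)
Lemma coef0_closed (P : K * seq (edge E) -> bool) (l : seq (K * seq (edge E))) w :
  all (fun c => closed_at w c.2) l ->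
  (\sum_(c <- l) c.1 *: (if P c then 'X^(size c.2) else 0 : {poly K}))`_0 = 0.
Proof.
move=> al; rewrite coef_sum big_seq big1 // => c cl; rewrite coefZ.
have /and3P[c0 _ _] := allP al c cl.
by case: ifP; rewrite ?coef0 ?mulr0 // coefXn; case: c.2 c0; rewrite //= mulr0.
Qed.

(** Acting on the constant function 1 and evaluating at [(w, 0)] gives the image of a polynomial
    with constant coefficient [k]. *)
Lemma unital_neq0 n w x : unital_at n w x -> x <> 0.
Proof.
move=> [k [_ [k0 [l [_ al ->]] ->]]] x0.
pose P (c : K * seq (edge E)) := strip c.2 w (w, 0) : bool.
pose p := k%:P + \sum_(c <- l) c.1 *: (if P c then 'X^(size c.2) else 0 : {poly K}).
have p0 : p`_0 != 0 by rewrite coefD coefC (coef0_closed _ al) addr0.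
(* The exponent 1 is an arbitrary positive choice. *)
have [R [phi [t' [tt' + _]]]] := poly_quotient p0 (ltn0Sn 0).
move=> /eqP; apply.
have := act0 E tt'; rewrite -x0 => /(congr1 (fun h => h (fun=> 1) (w, 0))).
move=> <-; rewrite (actD tt') (actZ tt') (act_sum tt') /p rmorphD rmorph_sum.
congr (_ + _).
  rewrite -[V w]/(path_elt [::] w) (act_path tt') /= eqxx mulr1 expr0.
  by rewrite -alg_polyC linearZ.
apply: eq_bigr => c _; rewrite /= linearZ (act_path tt') /P.
by case: strip => [j|]; rewrite ?mulr1 ?rmorph0.
Qed.

Lemma not_minimal_no_exit n w x q : (forall u, tree w u -> ~ bifurcation u) ->
  closed_at w q -> unital_at n w x -> ~ minimal_left_ideal (left_mult x).
Proof.
move=> nb cq [k [_ [k0 [l [_ al ->]] ->]]]; set x0 := _ + _ => minx.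
have wx0 : V w ** x0 = x0.
  rewrite numulDr -nuscaleAr vertex_mul eqxx nuscale_sumr; congr (_ + _).
  rewrite !big_seq; apply: eq_bigr => c /(allP al) /and3P[_ cw _].
  by rewrite vertex_path cw.
pose z := V w - path_elt q w.
(* Multiplying by [z] adds only closed paths of positive length, so the vertex term [k w] survives
   and the product is nonzero. *)
have zx : unital_at (size l + (1 + size l)) w (z ** x0).
  exists k, (\sum_(c <- l) c.1 *: path_elt c.2 w +
    -1 *: (k *: path_elt q w + \sum_(c <- l) c.1 *: (path_elt q w ** path_elt c.2 w))).
  split=> //; last first.
    rewrite numulBl wx0 [in RHS]addrA scaleN1r; congr (_ - _).
    by rewrite numulDr -nuscaleAr path_vertex eqxx nuscale_sumr.
  apply: closed_combD; first by exists l.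
  apply/closed_combZ/closed_combD; first exact/closed_combZ/closed_comb_path.
  apply: closed_comb_sum => c /(allP al) cc.
  have /and3P[_ /eqP cw _] := cc; rewrite -{2}cw path_elt_cat.
  exact/closed_comb_path/closed_at_cat.
have [a _ ax] : left_mult (z ** x0) x0.
  by rewrite (minimal_mull minx (unital_neq0 zx)); exact: left_mult_refl.
(* All closed paths act at [w] here; the constant condition [true] matches the form of
   [coef0_closed]. *)
pose p := k%:P + \sum_(c <- l) c.1 *: (if true then 'X^(size c.2) else 0 : {poly K}).
have p0 : p`_0 != 0 by rewrite coefD coefC (coef0_closed (fun=> true) al) addr0.
have /and3P[q0 /eqP qw qv] := cq.
have lq : (0 < size q)%N by case: q q0 {qw qv cq z zx ax}.
have [R [phi [t' [tt' pn0 pz]]]] := poly_quotient p0 lq.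
(* By [strip_nobif] a closed path at [w] fixes every point [(w, j)], so it acts there as a power of
   [phi 'X] that does not depend on [j]. *)
have actx : act (phi 'X) t' x0 (fun=> 1) = fun z => if z.1 == w then phi p else 0.
  apply/funext => -[v j]; rewrite (actD tt') (actZ tt') (act_sum tt') /p.
  rewrite rmorphD rmorph_sum /=.
  have strip_c p' : pstart p' w = w -> pvalid p' w ->
      strip p' w (v, j) = if v == w then Some j else None.
    by move=> p'w p'v; rewrite strip_nobif ?p'w.
  case: (v =P w) => vw.
    congr (_ + _).
      rewrite -[V w]/(path_elt [::] w) (act_path tt') /= vw eqxx mulr1 expr0.
      by rewrite -alg_polyC linearZ.
    rewrite !big_seq; apply: eq_bigr => c /(allP al) /and3P[_ /eqP cw cv].
    by rewrite linearZ /= (act_path tt') strip_c // vw eqxx mulr1.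
  rewrite -[V w]/(path_elt [::] w) (act_path tt') /=; case: eqP => // _.
  rewrite scaler0 add0r big_seq big1 // => c /(allP al) /and3P[_ /eqP cw cv].
  by rewrite (act_path tt') strip_c //; case: eqP => // _; rewrite scaler0.
(* On these functions [z] multiplies by the image of 1 - X^l, which annihilates [phi p]. Hence [x0],
   equal to [a ** (z ** x0)], would also send 1 to 0. *)
have actz : act (phi 'X) t' (z ** x0) (fun=> 1) = fun=> 0.
  rewrite (actM tt') actx; apply/funext => -[v j].
  rewrite /z -scaleN1r (actD tt') (actZ tt') -[V w]/(path_elt [::] w) !(act_path tt').
  rewrite (strip_nobif (p := q)) ?qw //=.
  case: eqP => // _; last by rewrite scaler0 addr0.
  by rewrite eqxx expr0 scaleN1r -mulrBl -rmorphB -rmorphM.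
move/eqP: pn0; apply.
have := congr1 (fun h => h (w, 0)) actx; rewrite /= eqxx => <-.
by rewrite -ax (actM tt') actz act_zero.
Qed.

End PathElements.

(** * Reduction to a vertex *)

Section Reduction.
Variables (K : fieldType) (E : graph).
Local Notation L := (leavitt K E).
Implicit Types (u v w : vertex E) (e f : edge E) (p q : seq (edge E)) (x y : L).
Local Notation V := (lvertex K).

Lemma vertex_neq0 v : V v <> 0 :> L.
Proof.
apply: (@unital_neq0 K E 0 v); exists 1, 0.
by rewrite oner_neq0 scale1r addr0; split=> //; exact: closed_comb0.
Qed.

(** If p^* q p is nonzero, then q p = p s and the product is s, a closed path of the same positive
    length as q. *)
Lemma conj_closed w q u p : closed_at w q -> pstart p u = w ->
  closed_comb 1 u (ghost_elt K p u ** path_elt K q w ** path_elt K p u).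
Proof.
move=> /and3P[q0 /eqP qw qv] pw; rewrite -{1}pw -numulA path_elt_cat.
have [|->|[s [qp su sv ->]]] := @ghost_path K E p u (q ++ p) u; first 2 last.
- apply: closed_comb_path; rewrite /closed_at su eqxx sv !andbT.
  have := congr1 size qp; rewrite !size_cat; case: s {su sv qp} => //=.
  by case: q q0 {qw qv} => //= ? ? _; lia.
- by rewrite size_cat leq_addl.
- exact: closed_comb0.
Qed.

Lemma conj_sum k (l : seq (K * seq (edge E))) w u p :
  pstart p u = w -> pvalid p u ->
  ghost_elt K p u ** (k *: V w + \sum_(c <- l) c.1 *: path_elt K c.2 w) ** path_elt K p u =
  k *: V u + \sum_(c <- l) c.1 *: (ghost_elt K p u ** path_elt K c.2 w ** path_elt K p u).
Proof.
move=> pw pv; rewrite numulDr numulDl nuscale_sumr nuscale_suml; congr (_ + _).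
by rewrite -nuscaleAr -nuscaleAl -numulA vertex_path pw eqxx ghost_path_id.
Qed.

(** Since p^* w p = u, the scalar is kept, and each closed path becomes a closed path or 0. *)
Lemma unital_conj n w x u p : pstart p u = w -> pvalid p u -> unital_at n w x ->
  unital_at n u (ghost_elt K p u ** x ** path_elt K p u).
Proof.
move=> pw pv [k [_ [k0 [l [ln al ->]] ->]]]; rewrite conj_sum //.
exists k, (\sum_(c <- l) c.1 *: (ghost_elt K p u ** path_elt K c.2 w ** path_elt K p u)).
split=> //; suff [r [rl ar ->]] : closed_comb (size l) u
    (\sum_(c <- l) c.1 *: (ghost_elt K p u ** path_elt K c.2 w ** path_elt K p u)).
  by exists r; split=> //; exact: leq_trans ln.
by apply: closed_comb_sum => c /(allP al) cc; exact: conj_closed.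
Qed.

(** If the conjugate by p e is nonzero, then p e is a prefix of q p e. As q is nonempty, the edge of
    q p at position |p| is then e; it cannot also be f. *)
Lemma conj_bifurcation w q p e f u : closed_at w q -> src e = u -> src f = u ->
  pstart p u = w -> e <> f ->
  ghost_elt K (rcons p e) (rng e) ** path_elt K q w ** path_elt K (rcons p e) (rng e) = 0 \/
  ghost_elt K (rcons p f) (rng f) ** path_elt K q w ** path_elt K (rcons p f) (rng f) = 0.
Proof.
move=> /and3P[q0 /eqP qw qv] eu fu pw ef.
have sE g : src g = u -> pstart (rcons p g) (rng g) = w.
  by move=> gu; rewrite -cats1 pstart_cat /= gu.
have q1 : (0 < size q)%N by case: q q0 {qw qv}.
have H g : src g = u ->
    ghost_elt K (rcons p g) (rng g) ** path_elt K q w ** path_elt K (rcons p g) (rng g) = 0 \/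
    nth g (q ++ p) (size p) = g.
  move=> gu; rewrite -(sE g gu) -numulA path_elt_cat.
  have [||[s [qp _ _ _]]] := @ghost_path K E (rcons p g) (rng g) (q ++ rcons p g) (rng g).
  - by rewrite size_cat leq_addl.
  - by left.
  right; have := congr1 (fun r => nth g r (size p)) qp.
  rewrite -rcons_cat nth_rcons size_cat [RHS]nth_cat size_rcons ltnSn.
  rewrite [RHS]nth_rcons ltnn eqxx.
  by rewrite -[X in (X < _)%N]add0n ltn_add2r q1.
have [|ge] := H e eu; first by left.
have [|gf] := H f fu; first by right.
case: ef; rewrite -ge -gf; apply: set_nth_default.
by rewrite size_cat -[X in (X < _)%N]add0n ltn_add2r.
Qed.

Lemma unital_vertex n w x : unital_at n w x -> minimal_left_ideal (left_mult x) ->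
  exists a b u, a ** x ** b = V u.
Proof.
(* Once no closed path remains, dividing by [k] gives the vertex. *)
have base v k : k != 0 -> exists a b u, a ** (k *: V v) ** b = V u.
  move=> k0; exists (k^-1 *: V v), (V v), v; rewrite -nuscaleAr -!nuscaleAl.
  by rewrite !vertex_mul eqxx scalerA mulfV // scale1r vertex_mul eqxx.
elim: n w x => [|n IH] w x ux minx; have [k [_ [k0 [[|c l] [sl al ->]] xE]]] := ux.
- by rewrite xE big_nil addr0; exact: base.
- by [].
- by rewrite xE big_nil addr0; exact: base.
case/andP: al => cc al.
have [nb|] := pselect (forall u, tree w u -> ~ bifurcation u).
  by case: (not_minimal_no_exit nb cc ux minx).
move=> /existsNP[u /not_implyP[[p]]]; rewrite is_pathE => /andP[/eqP pw pv].
move=> /contrapT[e [f [eu fu ef]]].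
(* One of the two edges kills the first closed path, so conjugation shortens the combination. *)
suff [g gu g0] : exists2 g, src g = u &
    ghost_elt K (rcons p g) (rng g) ** path_elt K c.2 w ** path_elt K (rcons p g) (rng g) = 0.
  set r := rcons p g in g0.
  have rw : pstart r (rng g) = w by rewrite /r -cats1 pstart_cat /= gu.
  have rv : pvalid r (rng g) by rewrite /r -cats1 pvalid_cat /= gu pv eqxx.
  have ur : unital_at n (rng g) (ghost_elt K r (rng g) ** x ** path_elt K r (rng g)).
    rewrite xE conj_sum // big_cons g0 scaler0 add0r -conj_sum //.
    apply: (unital_conj rw rv); exists k, (\sum_(d <- l) d.1 *: path_elt K d.2 w).
    by split=> //; exists l.
  have [minr _] := minimal_conj minx (unital_neq0 ur).
  have [a [b [v abv]]] := IH _ _ ur minr.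
  exists (a ** ghost_elt K r (rng g)), (path_elt K r (rng g) ** b), v.
  by rewrite -abv !numulA.
by have [g0|g0] := conj_bifurcation cc eu fu pw ef; [exists e | exists f].
Qed.

(** Conjugating by a path from [v] to [w] carries minimality to [w]. A bifurcation at [w] is
    excluded by the idempotent e e^*, and a cycle by [not_minimal_no_exit]. *)
Lemma minimal_vertex_line v :
  minimal_left_ideal (left_mult (V v)) -> line_points v.
Proof.
move=> minv.
have minw w : tree v w -> minimal_left_ideal (left_mult (V w)).
  move=> [p]; rewrite is_pathE => /andP[/eqP pv pw].
  have E1 : ghost_elt K p w ** V v ** path_elt K p w = V w.
    by rewrite -numulA vertex_path pv eqxx ghost_path_id.
  have [|] := @minimal_conj K E (ghost_elt K p w) (path_elt K p w) _ minv.
    by rewrite E1; exact: vertex_neq0.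
  by rewrite E1.
have nb w : tree v w -> ~ bifurcation w.
  move=> /minw minVw [e [f [ew fw ef]]].
  pose ee := ledge K e ** lghost K e.
  have eeV : ee ** V w = ee by rewrite /ee -numulA ghost_vertex ew eqxx.
  have ee0 : ee ** V w <> 0.
    rewrite eeV => ee0; apply: (@vertex_neq0 (rng e)).
    have := congr1 (fun y => lghost K e ** y ** ledge K e) ee0.
    rewrite numul0r numul0l /ee !numulA ghost_edge eqxx rng_ghost.
    by rewrite ghost_edge eqxx.
  (* Minimality gives w = a e e^*, hence f = w f = a e e^* f = 0 for the other edge f. *)
  have [a _] : left_mult (ee ** V w) (V w).
    by rewrite minimal_mull //; exact: left_mult_refl.
  rewrite eeV => aV; apply: (@vertex_neq0 (rng f)).
  have <- : lghost K f ** ledge K f = V (rng f) by rewrite ghost_edge eqxx.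
  have <- : V w ** ledge K f = ledge K f by rewrite vertex_edge fw eqxx.
  rewrite -aV /ee -!numulA ghost_edge; case: eqP => // _.
  by rewrite !numul0r.
move=> w vw; split; first exact: nb.
move=> [q /and3P[q0]]; rewrite is_pathE => /andP[qw qv] _.
apply: (@not_minimal_no_exit K E 0 w (V w) q _ _ _ (minw w vw)).
- by move=> u wu; apply: nb; exact: tree_trans vw wu.
- by rewrite /closed_at q0 qw qv.
- exists 1, 0; rewrite oner_neq0 scale1r addr0.
  by split=> //; exact: closed_comb0.
Qed.

(** * Removal of ghost edges *)

Definition real x := exists l : seq (K * (seq (edge E) * vertex E)),
  x = \sum_(c <- l) c.1 *: path_elt K c.2.1 c.2.2.

Lemma real0 : real 0. Proof. by exists [::]; rewrite big_nil. Qed.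

Lemma realD x y : real x -> real y -> real (x + y).
Proof. by move=> [l ->] [r ->]; exists (l ++ r); rewrite big_cat. Qed.

Lemma realZ k x : real x -> real (k *: x).
Proof.
move=> [l ->]; exists [seq (k * c.1, c.2) | c <- l].
by rewrite big_map scaler_sumr; apply: eq_bigr => c _; rewrite scalerA.
Qed.

Lemma real_path p w : real (path_elt K p w).
Proof. by exists [:: (1, (p, w))]; rewrite big_seq1 scale1r. Qed.

Lemma real_sum (T : Type) (l : seq T) (g : T -> L) :
  (forall c, real (g c)) -> real (\sum_(c <- l) g c).
Proof.
by move=> rg; apply: big_ind => //; [exact: real0 | exact: realD].
Qed.

Lemma real_vertex x v : real x -> real (x ** V v).
Proof.
move=> [l ->]; rewrite nuscale_suml; apply: real_sum => c; apply: realZ.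
by rewrite path_vertex; case: eqP => _; [exact: real_path | exact: real0].
Qed.

Lemma real_edge x e : real x -> real (x ** ledge K e).
Proof.
move=> [l ->]; rewrite nuscale_suml; apply: real_sum => c; apply: realZ.
by rewrite path_edge; case: eqP => _; [exact: real_path | exact: real0].
Qed.

Lemma real_vertexE x v : real x ->
  exists l : seq (K * seq (edge E)), x ** V v = \sum_(c <- l) c.1 *: path_elt K c.2 v.
Proof.
move=> [l ->]; exists [seq (c.1, c.2.1) | c <- l & c.2.2 == v].
rewrite nuscale_suml big_map big_filter [RHS]big_mkcond /=.
apply: eq_bigr => c _; rewrite path_vertex.
by case: eqP => [->|_]; rewrite ?scaler0.
Qed.

(** Multiplying by the ghost of a shortest path of the combination turns that
    path into a vertex and the others into closed paths. *)
Lemma real_unital (l : seq (K * seq (edge E))) w :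
  \sum_(c <- l) c.1 *: path_elt K c.2 w <> 0 ->
  exists p n, unital_at n w (ghost_elt K p w ** \sum_(c <- l) c.1 *: path_elt K c.2 w).
Proof.
set x := \sum_(c <- l) _ => x0.
(* Equal paths are merged first, because their coefficients might cancel. *)
pose s := undup [seq c.2 | c <- l].
pose k p := \sum_(c <- l | c.2 == p) c.1.
have xE : x = \sum_(p <- s) k p *: path_elt K p w.
  transitivity (\sum_(p <- s) \sum_(c <- l) if c.2 == p then c.1 *: path_elt K p w else 0).
    rewrite exchange_big /x /= !big_seq; apply: eq_bigr => c cl.
    rewrite (bigD1_seq c.2) ?undup_uniq ?mem_undup ?map_f //= eqxx big1 ?addr0 //.
    by move=> p; rewrite eq_sym => /negPf ->.
  apply: eq_bigr => p _; rewrite /k scaler_suml [RHS]big_mkcond /=.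
  by apply: eq_bigr => c _; case: eqP.
pose good p := pvalid p w && (k p != 0).
have ngood p : ~~ good p -> k p *: path_elt K p w = 0.
  rewrite negb_and negbK => /orP[/path_elt_invalid->|/eqP->].
    exact: scaler0.
  exact: scale0r.
have ex : exists m, has (fun p => good p && (size p == m)) s.
  apply: contrapT => nex; apply: x0; rewrite xE big_seq big1 // => p ps.
  apply: ngood; apply/negP => gp; apply: nex; exists (size p).
  by apply/hasP; exists p; rewrite ?gp ?eqxx.
have [_ /hasP[p ps /andP[gdp /eqP <-]] minp] := ex_minnP ex.
have /andP[pv kp] := gdp.
exists p, (size [seq q <- s | q != p]), (k p).
(* Terms that vanish are replaced by 0: the minimality of |p| says nothing about their lengths. *)
pose g q := if good q then ghost_elt K p w ** path_elt K q w else 0.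
exists (\sum_(q <- [seq q <- s | q != p]) k q *: g q); split=> //.
  apply: closed_comb_sum => q; rewrite mem_filter => /andP[qp qs].
  rewrite /g; case: ifP => [gq|_]; last exact: closed_comb0.
  have pq : (size p <= size q)%N.
    by apply: minp; apply/hasP; exists q; rewrite ?gq ?eqxx.
  have [->|[r [qE rw rv ->]]] := @ghost_path K E p w q w pq; first exact: closed_comb0.
  apply: closed_comb_path; rewrite /closed_at rw eqxx rv !andbT.
  by apply: contraNneq qp => r0; rewrite qE r0 cats0.
rewrite xE nuscale_sumr (bigD1_seq p) ?undup_uniq //= ghost_path_id // big_filter.
congr (_ + _); apply: eq_bigr => q _; rewrite /g; case: ifP => // /negbT /ngood q0.
by rewrite nuscaleAr q0 numul0r scaler0.
Qed.

(** If [y = y ** range_proj F], then y is the sum of the (y e) e^* for e in [F]: all its terms end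
    in ghosts of edges of [F]. *)
Definition range_proj (F : seq (edge E)) : L :=
  \sum_(e <- F) ledge K e ** lghost K e.

Lemma ghost_range_proj F e : uniq F -> e \in F ->
  lghost K e ** range_proj F = lghost K e.
Proof.
move=> uF eF; rewrite numul_sumr (bigD1_seq e) //= numulA ghost_edge eqxx.
rewrite rng_ghost big1 ?addr0 // => f fe; rewrite numulA ghost_edge eq_sym.
by rewrite (negPf fe) numul0l.
Qed.

Lemma range_proj_sub F F' : uniq F' -> {subset F <= F'} ->
  range_proj F ** range_proj F' = range_proj F.
Proof.
move=> uF sF; rewrite [LHS]numul_suml [RHS]big_seq [LHS]big_seq.
by apply: eq_bigr => e eF; rewrite -numulA ghost_range_proj // sF.
Qed.

Lemma range_proj_vertex F v : range_proj F ** V v = V v ** range_proj F.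
Proof.
rewrite numul_suml numul_sumr; apply: eq_bigr => e _.
rewrite -numulA ghost_vertex numulA vertex_edge.
by case: eqP => // _; rewrite numul0l numul0r.
Qed.

(** [ghost_deg n x]: [x] is a combination of products [p q^*] of paths with [q]
    of length at most [n]. *)
Fixpoint ghost_deg n x : Prop :=
  if n is m.+1 then
    (exists b F, [/\ real b, uniq F & x - b = (x - b) ** range_proj F]) /\
    forall e, ghost_deg m (x ** ledge K e)
  else real x.

Lemma ghost_deg0 n : ghost_deg n 0.
Proof.
elim: n => [|n IH] /=; first exact: real0.
split=> [|e]; last by rewrite numul0l.
by exists 0, [::]; split=> //; [exact: real0 | rewrite subrr numul0l].
Qed.

Lemma ghost_degS n x : ghost_deg n x -> ghost_deg n.+1 x.
Proof.
elim: n x => [|n IH] x; last by move=> [h1 h2]; split=> [|e]; [exact: h1 | exact/IH/h2].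
move=> rx; split=> [|e]; last exact: real_edge.
by exists x, [::]; split=> //; rewrite subrr numul0l.
Qed.

Lemma ghost_deg_le m n x : (m <= n)%N -> ghost_deg m x -> ghost_deg n x.
Proof.
move=> /subnK <-; elim: (n - m)%N => // d IH /IH; rewrite addSn.
exact: ghost_degS.
Qed.

Lemma ghost_degD n x y : ghost_deg n x -> ghost_deg n y -> ghost_deg n (x + y).
Proof.
elim: n x y => [|n IH] x y; first exact: realD.
move=> [[b [F [rb uF xb]]] xe] [[c [G [rc uG yc]]] ye].
split=> [|e]; last by rewrite numulDl; exact: IH (xe e) (ye e).
exists (b + c), (undup (F ++ G)); split; rewrite ?undup_uniq //; first exact: realD.
rewrite opprD addrACA numulDl; congr (_ + _).
  rewrite xb -numulA range_proj_sub ?undup_uniq // => e eF.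
  by rewrite mem_undup mem_cat eF.
rewrite yc -numulA range_proj_sub ?undup_uniq // => e eF.
by rewrite mem_undup mem_cat eF orbT.
Qed.

Lemma ghost_degZ n k x : ghost_deg n x -> ghost_deg n (k *: x).
Proof.
elim: n x => [|n IH] x; first exact: realZ.
move=> [[b [F [rb uF xb]]] xe]; split=> [|e]; last by rewrite -nuscaleAl; exact/IH/xe.
exists (k *: b), F; split=> //; first exact: realZ.
by rewrite -scalerBr -nuscaleAl -xb.
Qed.

Lemma ghost_deg_vertex n x v : ghost_deg n x -> ghost_deg n (x ** V v).
Proof.
elim: n x => [|n IH] x; first exact: real_vertex.
move=> [[b [F [rb uF xb]]] xe]; split=> [|e].
  exists (b ** V v), F; split=> //; first exact: real_vertex.
  by rewrite -numulBl {1}xb -!numulA range_proj_vertex.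
rewrite -numulA vertex_edge; case: eqP => _; first exact: xe.
by rewrite numul0r; exact: ghost_deg0.
Qed.

Lemma ghost_deg_edge n x e : ghost_deg n x -> ghost_deg n (x ** ledge K e).
Proof.
case: n => [|n]; first exact: real_edge.
by move=> [_ xe]; exact/ghost_degS/xe.
Qed.

Lemma ghost_deg_ghost n x e : ghost_deg n x -> ghost_deg n.+1 (x ** lghost K e).
Proof.
move=> xn; split=> [|f].
  exists 0, [:: e]; rewrite subr0 -numulA ghost_range_proj ?mem_head //.
  by split=> //; exact: real0.
rewrite -numulA ghost_edge; case: eqP => _; first exact: ghost_deg_vertex.
by rewrite numul0r; exact: ghost_deg0.
Qed.

Lemma ghost_deg_mulr a x : (exists n, ghost_deg n x) -> exists n, ghost_deg n (x ** a).
Proof.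
elim/leavitt_ind: a x => [|v|e|e|a b IHa IHb|k a IHa|a b IHa IHb] x [n xn].
- by exists n; rewrite numul0r; exact: ghost_deg0.
- by exists n; exact: ghost_deg_vertex.
- by exists n; exact: ghost_deg_edge.
- by exists n.+1; exact: ghost_deg_ghost.
- have [m am] := IHa x (ex_intro _ n xn); have [l bl] := IHb x (ex_intro _ n xn).
  exists (maxn m l); rewrite numulDr; apply: ghost_degD.
    exact: ghost_deg_le (leq_maxl _ _) am.
  exact: ghost_deg_le (leq_maxr _ _) bl.
- have [m am] := IHa x (ex_intro _ n xn).
  by exists m; rewrite -nuscaleAr; exact: ghost_degZ.
- have [m am] := IHa x (ex_intro _ n xn).
  by rewrite numulA; apply: IHb; exists m.
Qed.

(** Write x = u x with u a sum of vertices, which is real, and multiply u by x on the right. *)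
Lemma ghost_deg_ex x : exists n, ghost_deg n x.
Proof.
have [F0 /(_ (undup F0) (undup_uniq _))] := local_unit x.
case=> [v|<- _]; first by rewrite mem_undup.
apply: ghost_deg_mulr; exists 0%N => /=.
by apply: real_sum => v; exact: (real_path [::]).
Qed.

(** If b s(f) were nonzero, some p^* b s(f) would have a nonzero vertex term. Conjugating by f would
    keep that term, yet the result contains the factor b f = 0. *)
Lemma real_annihilator b f : real b -> b ** ledge K f = 0 -> b ** V (src f) = 0.
Proof.
move=> rb bf; apply: contrapT => bv.
have [l bE] := real_vertexE (src f) rb.
rewrite bE in bv; have [p [n]] := real_unital bv; rewrite -bE => un.
have := @unital_conj n (src f) _ (rng f) [:: f] erefl _ un; rewrite /= eqxx.
move=> /(_ isT) /unital_neq0; apply.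
rewrite edge_rng -!numulA vertex_edge eqxx bf.
by rewrite !numul0r.
Qed.

Lemma vertex_component x : x <> 0 -> exists u, x ** V u <> 0.
Proof.
move=> x0; have [F _ xF] := right_unit x.
apply: contrapT => h; apply: x0; rewrite xF big1 // => v _.
by apply: contrapT => xv; apply: h; exists v.
Qed.

(** If some x e is nonzero, its ghost degree is smaller. Otherwise all edges kill x, and a component
    x u can be nonzero only when u is a sink, where x u = b u is real. *)
Lemma ghost_deg_real n x : ghost_deg n x -> x <> 0 ->
  exists b w (l : seq (K * seq (edge E))),
    x ** b = \sum_(c <- l) c.1 *: path_elt K c.2 w /\ x ** b <> 0.
Proof.
elim: n x => [|n IH] x.
  move=> rx /vertex_component[u xu]; have [l xE] := real_vertexE u rx.
  by exists (V u), u, l.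
move=> [[b [F [rb uF xb]]] xe] x0.
have [[e xe0]|nexe] := pselect (exists e, x ** ledge K e <> 0).
  have [c [w [l [xl xc]]]] := IH _ (xe e) xe0.
  by exists (ledge K e ** c), w, l; rewrite numulA.
have xe0 e : x ** ledge K e = 0 by apply: contrapT => h; apply: nexe; exists e.
have [u xu0] := vertex_component x0.
have xE : x = b - b ** range_proj F.
  suff <- : (x - b) ** range_proj F = - (b ** range_proj F).
    by rewrite -xb addrC subrK.
  rewrite numulBl (_ : x ** _ = 0) ?sub0r //.
  by rewrite numul_sumr big1 // => e _; rewrite numulA xe0 numul0l.
have xuE : x ** V u = b ** V u -
    b ** range_proj [seq e <- F | src e == u].
  rewrite xE numulBl; congr (_ - _); rewrite -numulA; congr (_ ** _).
  rewrite numul_suml /range_proj big_filter [RHS]big_mkcond /=.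
  apply: eq_bigr => e _; rewrite -numulA ghost_vertex.
  by case: eqP => // _; rewrite numul0r.
(* For an edge f outside [F] the correction term vanishes on f, so b f = x f = 0 and b u = 0. *)
have [[f fu fF]|nex] := pselect (exists2 f, src f = u & f \notin F).
  have bu : b ** V u = 0.
    rewrite -fu; apply: real_annihilator => //.
    have := xe0 f; rewrite xE numulBl -numulA numul_suml big_seq.
    rewrite big1 ?numul0r ?subr0 // => e eF.
    rewrite -numulA ghost_edge; case: eqP => [ef|]; last by rewrite numul0r.
    by rewrite -ef eF in fF.
  case: xu0; rewrite xuE bu sub0r numul_sumr big_filter big1 ?oppr0 // => e /eqP eu.
  by rewrite -src_edge !numulA eu bu !numul0l.
have subF e : src e = u -> e \in F.
  by move=> eu; apply: contrapT => /negP eF; apply: nex; exists e.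
(* Now [F] contains all edges out of u. If u is regular, relation (4) gives x u = b u - b u = 0. *)
have [ru|nru] := pselect (regular u).
  case: xu0; rewrite xuE /range_proj (@ck2 K E u) ?filter_uniq ?subrr // => e.
  rewrite mem_filter; case: eqP => //= /subF ->//.
(* Finitely many edges leave u and u is not regular, so none does and the correction term is
   empty. *)
have [l bl] := real_vertexE u rb.
exists (V u), u, l; rewrite -bl; split=> //.
rewrite xuE /range_proj big_filter big1_seq ?numul0r ?subr0 // => e /andP[/eqP eu _].
case: nru; split; last by exists e.
apply: sub_finite_set (finite_seq F) => f /= fu.
exact: subF.
Qed.

End Reduction.

Theorem theorem4p13 (K : fieldType) (E : graph) (x : leavitt K E) :
  minimal_left_ideal (left_mult x) ->
  exists v : vertex E, line_points v /\
    left_ideal_iso (left_mult x) (left_mult (lvertex K v)).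
Proof.
move=> minx; have [n xn] := ghost_deg_ex x.
have [b [w [l [xbE xb0]]]] := ghost_deg_real xn (minimal_neq0 minx).
rewrite xbE in xb0; have [p [m]] := real_unital xb0; rewrite -xbE numulA => um.
have [minum _] := minimal_conj minx (unital_neq0 um).
have [a [c [v vE]]] := unital_vertex um minum.
(* Collecting all factors around [x] yields the isomorphism in one application of [minimal_conj],
   without composing isomorphisms. *)
have vE' : (a ** ghost_elt K p w) ** x ** (b ** c) = lvertex K v by rewrite -vE !numulA.
have [|minv iso] := @minimal_conj _ _ (a ** ghost_elt K p w) (b ** c) _ minx.
  by rewrite vE'; exact: vertex_neq0.
by rewrite vE' in minv iso; exists v; split;
  [exact: minimal_vertex_line minv | exact: iso].
Qed.
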